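(* There exists a constant $c>0$ such that the following holds. Let $G_M$ be the final graph produced by the $Q_2$-free process in the hypercube $Q_d$, and let $v$ be a vertex of $Q_d$ chosen uniformly at random. Then with high probability (i.e. with probability tending to $1$ as $d\to\infty$), the degree of $v$ in $G_M$ is at least $c\,d^{2/3}$.
   Context: $Q_d$ denotes the $d$-dimensional hypercube graph: vertex set $\{0,1\}^d$, two vertices adjacent iff they differ in exactly one coordinate. $Q_2$ is the 4-cycle. The $Q_2$-free process in $Q_d$ is defined as follows: start with $G_0$ the graph on $V(Q_d)$ with no edges; given $G_i$, choose an edge uniformly at random among all edges $e\in E(Q_d)\setminus E(G_i)$ such that $G_i+e$ contains no copy of $Q_2$ (as a subgraph), and let $G_{i+1}=G_i+e$. The process stops at the first $M$ for which no such edge exists; $G_M$ is the resulting graph. Equivalently, take a uniformly random ordering of $E(Q_d)$ and scan the edges in order, adding each edge if it does not create a copy of $Q_2$ with the edges already added. *)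

(* Defs.v *)
From HB Require Import structures.
From mathcomp Require Import all_boot all_order all_algebra.
From mathcomp Require Import reals.
Set Implicit Arguments.
Unset Strict Implicit.
Unset Printing Implicit Defensive.
Import Order.TTheory GRing.Theory Num.Theory.
Local Open Scope ring_scope.

Definition cube (d : nat) : finType := {ffun 'I_d -> bool}.

Definition cube_adj d (x y : cube d) : bool :=
  #|[set i : 'I_d | x i != y i]| == 1%N.

Definition cube_edges d : {set {set cube d}} :=
  [set e | [exists x : cube d, exists y : cube d,
              cube_adj x y && (e == [set x; y])]].

(* A graph on the vertex set of Q_d is represented by its set of edges, each
   edge being the set of its two endpoints. *)
Definition graph (d : nat) : finType := {set {set cube d}}.

Definition degree d (G : graph d) (v : cube d) : nat :=
  #|[set e in G | v \in e]|.

Definition contains_Q2 d (G : graph d) : bool :=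
  [exists f : {ffun cube 2 -> cube d},
     injectiveb f && [forall e in cube_edges 2, [set f x | x in e] \in G]].

Definition allowed d (G : graph d) : {set {set cube d}} :=
  [set e in cube_edges d :\: G | ~~ contains_Q2 (e |: G)].

Section Process.
Variable R : realType.

(* Graphs without allowed edges are absorbing, so that the process is defined
   for all times: G_i = G_M for every i >= M. *)
Definition step_prob d (G H : graph d) : R :=
  if allowed G == set0 then (H == G)%:R
  else \sum_(e in allowed G | H == e |: G) #|allowed G|%:R^-1.

Fixpoint process_law d (i : nat) (H : graph d) : R :=
  if i is j.+1 then \sum_(G : graph d) process_law j G * step_prob G H
  else (H == set0)%:R.

(* Every step before absorption adds an edge of Q_d, hence M <= #|E(Q_d)| and
   G_M is the graph at time #|E(Q_d)|. *)
Definition final_law d (H : graph d) : R := process_law #|cube_edges d| H.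

(* The probability of an event depending on G_M and on an independent,
   uniformly distributed vertex v. *)
Definition prob_final_vertex d (A : graph d -> cube d -> bool) : R :=
  \sum_(v : cube d) \sum_(G : graph d | A G v) final_law G / #|cube d|%:R.

End Process.

(* Main.v *)
(* Take a random set [S] containing each edge independently with probability
   [p = d^(-1/3) / 2], and test the elements of [S] in random order before the
   process goes on. Whatever the order, every edge of [S] lying in no copy of
   Q_2 inside [S] is accepted, so the final degree of [v] is at least [X - Y],
   where [X] counts the edges of [S] at [v] and [Y] the pairs [(i, j)] such that
   the square at [v] in directions [i] and [j] lies in [S]. The mean of [X] is
   [d^(2/3) / 2], that of [Y] is at most [d^(2/3) / 16], both variances are
   [O(d^(2/3))], and Chebyshev's inequality concludes with [c = 1/8]. *)
Require Import Defs.
From HB Require Import structures.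
From mathcomp Require Import all_boot all_order all_algebra.
From mathcomp Require Import reals ring lra.
Set Implicit Arguments.
Unset Strict Implicit.
Unset Printing Implicit Defensive.
Import Order.TTheory GRing.Theory Num.Theory.
Local Open Scope ring_scope.

(** * Moments of a binomial random subset *)

Section RandomSubset.
Variables (R : realFieldType) (T : finType) (p : R).
Implicit Types (S U : {set T}).

Definition weight S : R := p ^+ #|S| * (1 - p) ^+ #|~: S|.

Lemma sum_weight_sup U : \sum_(S : {set T} | U \subset S) weight S = p ^+ #|U|.
Proof.
(* When the product of [F x + G x] is expanded over all [S], the vanishing of [G] on [U] leaves only
   the [S] containing [U]; off [U] each factor is 1. *)
pose F (x : T) := p; pose G (x : T) := if x \in U then 0 else 1 - p.
have H := @bigA_distr R 0 1 *%R +%R T F G.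
have -> : p ^+ #|U| = \prod_x (F x + G x).
  rewrite (bigID (mem U)) /= [X in _ * X]big1 ?mulr1; last first.
    by move=> x xU; rewrite /F /G (negbTE xU) subrKC.
  rewrite (eq_bigr (fun=> p)) ?prodr_const //.
  by move=> x xU; rewrite /F /G xU addr0.
rewrite H big_mkcond /=; apply: eq_bigr => S _.
case: ifPn => [US|/subsetPn[x xU xS]]; last first.
  by rewrite (bigD1 x) //= (negbTE xS) /G xU mul0r.
rewrite (bigID (mem S)) /= /weight; congr (_ * _).
  rewrite (eq_bigr (fun=> p)) ?prodr_const //.
  by move=> x xS; rewrite xS.
rewrite -prodr_const; apply: eq_big => [x|x]; rewrite inE // => xS.
by rewrite (negbTE xS) /G; case: ifP xS => // /(subsetP US) ->.
Qed.

Definition mean (f : {set T} -> R) : R := \sum_(S : {set T}) weight S * f S.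

Lemma mean_sup U : mean (fun S => (U \subset S)%:R) = p ^+ #|U|.
Proof.
rewrite -sum_weight_sup [RHS]big_mkcond; apply: eq_bigr => S _.
by case: (U \subset S); rewrite ?mulr1 ?mulr0.
Qed.

Lemma mean_const c : mean (fun=> c) = c.
Proof.
rewrite /mean -mulr_suml -[RHS]mul1r; congr (_ * _).
(* The total weight is the case of an empty [U]. *)
rewrite -(expr0 p) -(@cards0 T) -sum_weight_sup.
by apply: eq_bigl => S; rewrite sub0set.
Qed.

Lemma meanD f g : mean (fun S => f S + g S) = mean f + mean g.
Proof. by rewrite /mean -big_split; apply: eq_bigr => S _; rewrite mulrDr. Qed.

Lemma meanZ c f : mean (fun S => c * f S) = c * mean f.
Proof. by rewrite /mean mulr_sumr; apply: eq_bigr => S _; rewrite mulrCA. Qed.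

Lemma mean_sum (I : finType) (P : pred I) (f : I -> {set T} -> R) :
  mean (fun S => \sum_(i | P i) f i S) = \sum_(i | P i) mean (f i).
Proof.
rewrite /mean exchange_big; apply: eq_bigr => S _; by rewrite mulr_sumr.
Qed.

Lemma eq_mean f g : f =1 g -> mean f = mean g.
Proof. by move=> fg; apply: eq_bigr => S _; rewrite fg. Qed.

Hypothesis p01 : 0 <= p <= 1.

Lemma weight_ge0 S : 0 <= weight S.
Proof.
by case/andP: p01 => p0 p1; rewrite mulr_ge0 ?exprn_ge0 // subr_ge0.
Qed.

Lemma le_mean f g : (forall S, f S <= g S) -> mean f <= mean g.
Proof. by move=> fg; apply: ler_sum => S _; rewrite ler_wpM2l ?weight_ge0. Qed.

(* Events [U a \subset S] and [U b \subset S] with [U a] and [U b] disjoint are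
   independent, so only the intersecting pairs contribute to the variance. *)
Lemma variance_sub (A : finType) (P : pred A) (U : A -> {set T}) (t : nat) :
    (forall a, P a -> #|U a| = t) ->
  mean (fun S => (\sum_(a | P a) (U a \subset S)%:R - #|P|%:R * p ^+ t) ^+ 2)
    <= \sum_(a | P a) \sum_(b | P b)
         (if [disjoint U a & U b] then 0 else p ^+ #|U a :|: U b|).
Proof.
move=> Ut; have p0 : 0 <= p by case/andP: p01.
set m := _ * _.
have mE : m = \sum_(a | P a) p ^+ t by rewrite sumr_const /m mulr_natl.
have E1 : mean (fun S => \sum_(a | P a) (U a \subset S)%:R) = m.
  by rewrite mean_sum mE; apply: eq_bigr => a Pa; rewrite mean_sup Ut.
have E2 : mean (fun S => (\sum_(a | P a) (U a \subset S)%:R) ^+ 2) =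
    \sum_(a | P a) \sum_(b | P b) p ^+ #|U a :|: U b|.
  transitivity (mean (fun S => \sum_(a | P a) \sum_(b | P b)
      (U a :|: U b \subset S)%:R)).
    apply: eq_mean => S; rewrite expr2 big_distrlr /=.
    apply: eq_bigr => a _; apply: eq_bigr => b _.
    by rewrite subUset -natrM mulnb.
  rewrite mean_sum; apply: eq_bigr => a _.
  by rewrite mean_sum; apply: eq_bigr => b _; rewrite mean_sup.
rewrite (@eq_mean _ (fun S => (\sum_(a | P a) (U a \subset S)%:R) ^+ 2 +
   (- (2 * m) * (\sum_(a | P a) (U a \subset S)%:R) + m ^+ 2))); last first.
  by move=> S; ring.
rewrite meanD E2 meanD meanZ E1 mean_const.
have -> : - (2 * m) * m + m ^+ 2 = - m ^+ 2 by ring.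
(* Spread over the pairs, [m ^+ 2] cancels the disjoint pairs exactly; for the other pairs a
   nonnegative term is dropped. *)
have -> : m ^+ 2 = \sum_(a | P a) \sum_(b | P b) p ^+ t * p ^+ t.
  by rewrite mE expr2 big_distrlr.
rewrite lerBlDr -big_split /=.
apply: ler_sum => a Pa; rewrite -big_split; apply: ler_sum => b Pb /=.
case: ifP => [dab|_]; last by rewrite lerDl mulr_ge0 ?exprn_ge0.
by rewrite add0r cardsU (disjoint_setI0 dab) cards0 subn0 !Ut // exprD.
Qed.

End RandomSubset.

(** * The process and its equivalence with a random scan *)

Section Process.
Variables (R : realType) (d : nat).
Implicit Types (G H : graph d) (S : {set {set cube d}}) (f : graph d -> R).

(** The transition operator on functions, dual to [step_prob]: expectations are pulled back to the
    starting graph. *)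
Definition step_mean f G : R :=
  if allowed G == set0 then f G
  else (\sum_(e in allowed G) f (e |: G)) / #|allowed G|%:R.

Lemma step_probE f G : \sum_H step_prob R G H * f H = step_mean f G.
Proof.
rewrite /step_prob /step_mean; case: ifP => _.
  rewrite (bigD1 G) //= eqxx mul1r big1 ?addr0 // => H /negbTE->.
  by rewrite mul0r.
rewrite mulr_suml; under eq_bigr do rewrite mulr_suml big_mkcondr.
rewrite exchange_big; apply: eq_bigr => e _; rewrite -big_mkcond /=.
by rewrite big_pred1_eq mulrC.
Qed.

Lemma process_lawE f n :
  \sum_H process_law R n H * f H = iter n step_mean f set0.
Proof.
elim: n f => [|n IHn] f /=.
  rewrite (bigD1 set0) //= eqxx mul1r big1 ?addr0 // => H /negbTE->.
  by rewrite mul0r.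
rewrite -iterS iterSr -IHn; under eq_bigr do rewrite mulr_suml.
rewrite exchange_big; apply: eq_bigr => G _.
rewrite -step_probE mulr_sumr; apply: eq_bigr => H _; by rewrite mulrA.
Qed.

Lemma step_mean_bounds f (a b : R) :
  (forall G, a <= f G <= b) -> forall G, a <= step_mean f G <= b.
Proof.
move=> fab G; rewrite /step_mean; case: ifPn => // A0.
have n0 : 0 < #|allowed G|%:R :> R by rewrite ltr0n card_gt0.
rewrite ler_pdivlMr // ler_pdivrMr // !mulr_natr -!sumr_const.
by rewrite !ler_sum // => e _; case/andP: (fab (e |: G)).
Qed.

Lemma iter_step_mean_bounds f (a b : R) n :
  (forall G, a <= f G <= b) -> forall G, a <= iter n step_mean f G <= b.
Proof. by move=> fab; elim: n => //= n IHn; apply: step_mean_bounds. Qed.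

(** The graph only grows, so a value forced on all supergraphs of [G] survives every step. *)
Lemma iter_step_mean_sup f (c : R) n G :
  (forall H, G \subset H -> f H = c) -> iter n step_mean f G = c.
Proof.
elim: n G => [|n IHn] G fc /=; first exact: fc.
have fe e : iter n step_mean f (e |: G) = c.
  by apply: IHn => H eGH; apply: fc; apply: subset_trans eGH; apply: subsetUr.
rewrite /step_mean; case: ifPn => [_|A0]; first exact: IHn.
rewrite (eq_bigr (fun=> c)) ?sumr_const // -[c *+ _]mulr_natr mulfK //.
by rewrite pnatr_eq0 cards_eq0.
Qed.

Lemma contains_Q2S G H : G \subset H -> contains_Q2 G -> contains_Q2 H.
Proof.
move=> GH /existsP[f /andP[fi /forall_inP fG]]; apply/existsP; exists f.
by rewrite fi; apply/forall_inP => e /fG; apply: (subsetP GH).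
Qed.

Lemma allowed_add G e :
  e \in allowed G -> allowed (e |: G) \subset allowed G :\ e.
Proof.
move=> eA; apply/subsetP => e'; rewrite !inE negb_or -!andbA.
case/and4P=> -> e'G e'E; rewrite e'G e'E; apply: contra.
by apply: contains_Q2S; rewrite setUCA subsetUr.
Qed.

(** Every step taken strictly shrinks the allowed set, so [n] steps already reach absorption. *)
Lemma step_mean_stable f n G :
  (#|allowed G| <= n)%N -> iter n.+1 step_mean f G = iter n step_mean f G.
Proof.
elim: n G => [|n IHn] G.
  by rewrite leqn0 cards_eq0 /= /step_mean => ->.
move=> An.
have stepE g : step_mean g G = if allowed G == set0 then g G
  else (\sum_(e in allowed G) g (e |: G)) / #|allowed G|%:R by [].
rewrite -[LHS]/(step_mean (iter n.+1 step_mean f) G).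
rewrite -[RHS]/(step_mean (iter n step_mean f) G) !stepE; case: ifPn => A0.
  by apply: IHn; rewrite (eqP A0) cards0.
congr (_ / _); apply: eq_bigr => e eA; apply: IHn.
rewrite -ltnS (leq_trans _ An) // (cardsD1 e (allowed G)) eA.
by rewrite ltnS subset_leq_card ?allowed_add.
Qed.

(** Expectation at the end of the process started from an arbitrary graph; by [step_mean_stable]
    this number of steps suffices for every start. *)
Definition final_mean f := iter #|cube_edges d| step_mean f.

Lemma final_lawE f : \sum_H final_law R H * f H = final_mean f set0.
Proof. exact: process_lawE. Qed.

(** Harmonicity of [final_mean f], multiplied out so as to cover an absorbed [G]. *)
Lemma final_mean_step f G :
  \sum_(e in allowed G) final_mean f (e |: G) =
  #|allowed G|%:R * final_mean f G.
Proof.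
have AE : (#|allowed G| <= #|cube_edges d|)%N.
  by apply: subset_leq_card; apply/subsetP => e; rewrite !inE => /andP[/andP[]].
have := step_mean_stable f AE; rewrite -/(final_mean f) /= => <-.
rewrite /step_mean; case: ifPn => [/eqP->|A0]; first by rewrite big_set0 cards0 mul0r.
by rewrite mulrC divfK // pnatr_eq0 cards_eq0.
Qed.

Definition test_edge e G := if e \in allowed G then e |: G else G.

(* The [k] elements of [S] are tested in uniformly random order, and then the
   process is run to its end. *)
Fixpoint scan_mean f k G S : R :=
  if k is j.+1 then (\sum_(e in S) scan_mean f j (test_edge e G) (S :\ e)) / k%:R
  else final_mean f G.

(* Testing an edge that is not allowed has no effect, so testing a uniformly
   random element of any superset of the allowed edges, forgetting it when it is
   rejected, does not change the law of the final graph. *)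
Lemma sum_scan_mean f k G S : allowed G \subset S ->
  \sum_(U : {set {set cube d}} | (U \subset S) && (#|U| == k)) scan_mean f k G U =
  'C(#|S|, k)%:R * final_mean f G.
Proof.
elim: k G S => [|k IHk] G S AS.
  rewrite bin0 mul1r (big_pred1 set0) // => U.
  rewrite /= cards_eq0; case: (U =P set0) => [->|_]; first by rewrite sub0set.
  by rewrite andbF.
rewrite -mulr_suml.
(* Double counting of the pairs of a set and its first tested element. *)
have -> : \sum_(U : {set {set cube d}} | (U \subset S) && (#|U| == k.+1))
     \sum_(e in U) scan_mean f k (test_edge e G) (U :\ e) =
   \sum_(e in S) \sum_(U : {set {set cube d}} | (U \subset S :\ e) && (#|U| == k))
     scan_mean f k (test_edge e G) U.
  rewrite (exchange_big_dep (mem S)) /=; last first.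
    by move=> U e /andP[/subsetP US _] /US.
  apply: eq_bigr => e eS.
  rewrite (reindex_onto (fun U => e |: U) (fun U => U :\ e)) /=; last first.
    by move=> U /andP[_ eU]; rewrite setD1K.
  apply: eq_big => [U|U].
    rewrite subsetD1 subUset sub1set eS setU11 andbT /=.
    case: (boolP (e \in U)) => eU.
      rewrite andbF /= [_ == U]negbTE ?andbF //.
      by apply: contraTneq eU => <-; rewrite !inE eqxx.
    by rewrite setU1K // eqxx !andbT cardsU1 eU.
  by case/andP=> _ /eqP->.
(* Induction applies because, whether [e] is accepted or rejected, the edges allowed afterwards lie
   in [S :\ e]. *)
transitivity ('C(#|S|.-1, k)%:R * (\sum_(e in S) final_mean f (test_edge e G)) / k.+1%:R).
  congr (_ / _); rewrite mulr_sumr; apply: eq_bigr => e eS.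
  rewrite IHk ?[#|S|](cardsD1 e) ?eS // /test_edge.
  rewrite subsetD1; case: ifPn => [eA|->]; last by rewrite AS.
  rewrite -subsetD1 (subset_trans (allowed_add eA)) // setSD //.
(* Allowed elements are handled by harmonicity; each rejected one leaves [G] unchanged. *)
have -> : \sum_(e in S) final_mean f (test_edge e G) = #|S|%:R * final_mean f G.
  rewrite (big_setID (allowed G)) /= (setIidPr AS).
  rewrite (eq_bigr (fun e => final_mean f (e |: G))); last first.
    by move=> e eA; rewrite /test_edge eA.
  rewrite final_mean_step [X in _ + X](eq_bigr (fun=> final_mean f G)); last first.
    by move=> e; rewrite inE /test_edge => /andP[/negbTE->].
  rewrite sumr_const -[final_mean f G *+ _]mulr_natl -mulrDl -natrD cardsD (setIidPr AS) subnKC //.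
  exact: subset_leq_card.
have k0 : k.+1%:R != 0 :> R by rewrite pnatr_eq0.
apply: (canLR (mulfK k0)); rewrite mulrA -natrM [in LHS]mulnC mul_bin_diag.
by rewrite natrM; ring.
Qed.

(** Given its size, [S] is uniform among the sets of that size, so [sum_scan_mean] over the full
    ground set applies; the binomial weights add up to 1. *)
Lemma mean_scan_mean (p : R) f :
  mean p (fun S => scan_mean f #|S| set0 S) = final_mean f set0.
Proof.
have [n nE] : exists n, n = #|{set cube d}| by exists #|{set cube d}|.
have cardC S : #|~: S| = (n - #|S|)%N by rewrite nE cardsCs setCK.
rewrite /mean (partition_big (fun S => inord #|S| : 'I_n.+1) predT) //=.
transitivity (\sum_(k < n.+1) (p ^+ k * (1 - p) ^+ (n - k) *
    ('C(n, k)%:R * final_mean f set0))); last first.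
  transitivity ((1 - p + p) ^+ n * final_mean f set0); last first.
    by rewrite subrK expr1n mul1r.
  rewrite exprDn mulr_suml; apply: eq_bigr => k _.
  by rewrite [(1 - p) ^+ _ * _]mulrC mulr_natl mulrnAr mulrnAl.
apply: eq_bigr => k _; have := @sum_scan_mean f k set0 setT (subsetT _).
rewrite cardsT -nE => <-; rewrite mulr_sumr; apply: eq_big => S.
  by rewrite subsetT /= -val_eqE /= inordK // ltnS nE max_card.
move=> /eqP kE; have <- : #|S| = k by rewrite -kE inordK // ltnS nE max_card.
by rewrite /weight cardC.
Qed.

Lemma scan_mean_ge0 f k G S : (forall H, 0 <= f H) -> 0 <= scan_mean f k G S.
Proof.
move=> f0; elim: k G S => [|k IHk] G S /=.
  rewrite /final_mean; elim: #|_| G => //= n IHn G; rewrite /step_mean.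
  by case: ifP => // _; rewrite divr_ge0 ?sumr_ge0.
by rewrite divr_ge0 ?sumr_ge0.
Qed.

(* The random set [S] ranges over sets of arbitrary sets of vertices, hence the
   intersections with the edges of Q_d. *)
Definition isolated S : graph d :=
  [set e in S :&: cube_edges d |
     ~~ [exists f : {ffun cube 2 -> cube d},
       [&& injectiveb f,
           [forall e in cube_edges 2,
              [set f x | x in e] \in S :&: cube_edges d] &
           [exists e' in cube_edges 2, e == [set f x | x in e']]]]].

(** During the scan of [S0], [G] holds accepted edges and [S] the untested elements; the invariant
    is that every isolated edge is in one of the two. *)
Lemma scan_mean_isolated f S0 (c : R) :
  (forall H, isolated S0 \subset H -> f H = c) ->
  forall k G S, #|S| = k -> S \subset S0 -> G \subset S0 :&: cube_edges d ->
    isolated S0 \subset G :|: S -> ~~ contains_Q2 G ->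
  scan_mean f k G S = c.
Proof.
move=> fc; elim=> [|k IHk] G S Sk SS0 GS0 iGS GQ /=.
  apply: iter_step_mean_sup => H GH; apply: fc; apply: subset_trans GH.
  by move: iGS; rewrite (cards0_eq Sk) setU0.
rewrite (eq_bigr (fun=> c)) ?sumr_const ?Sk -?[c *+ _]mulr_natr ?mulfK ?pnatr_eq0 //.
move=> e eS; have eS0 := subsetP SS0 _ eS.
apply: IHk.
- by move: Sk; rewrite (cardsD1 e) eS => -[].
- by rewrite (subset_trans _ SS0) // subD1set.
- rewrite /test_edge; case: ifP => // eA; rewrite subUset GS0 sub1set inE eS0.
  by move: eA; rewrite inE => /andP[/setDP[-> _] _].
- apply/subsetP => e' e'i; have := subsetP iGS _ e'i.
  rewrite /test_edge; case: ifPn => eA.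
    by rewrite !in_setU !in_setD1 in_set1; case: (e' =P e).
  rewrite !in_setU in_setD1; case: (e' =P e) => //= e'e.
  case/orP => [->//|_]; rewrite orbF; apply: contraNT eA => eG.
  rewrite e'e in e'i eG.
  move: e'i; rewrite !inE => /andP[/andP[_ eE]] eQ; rewrite eG eE /=.
  (* A rejected [e] closes a copy of Q_2 lying inside [S0], against isolation. *)
  apply: contra eQ => /existsP[g /andP[gi /forall_inP gG]].
  apply/existsP; exists g; rewrite gi /=; apply/andP; split.
    apply/forall_inP => e1 /gG; rewrite in_setU1 => /predU1P[->|].
      by rewrite !inE eS0 eE.
    exact: subsetP GS0 _.
  (* The copy uses [e], since otherwise it would lie in the Q_2-free graph [G]. *)
  apply: contraR GQ; rewrite negb_exists => /forallP ng.
  apply/existsP; exists g; rewrite gi; apply/forall_inP => e1 e1E.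
  have := gG _ e1E; rewrite in_setU1 eq_sym.
  by move: (ng e1); rewrite e1E /= => /negbTE->.
- by rewrite /test_edge; case: ifP; rewrite // inE => /andP[].
Qed.

End Process.

(** * Edges and squares at a vertex *)

Definition flip d (v : cube d) (A : {set 'I_d}) : cube d :=
  [ffun k => v k (+) (k \in A)].

(** With [v] as origin, an edge is coded by its endpoint nearer to [v] and its direction. For
    [l \notin A] the code is unique, so edges can be counted by codes. *)
Definition flip_edge d (v : cube d) (A : {set 'I_d}) (l : 'I_d) : {set cube d} :=
  [set flip v A; flip v (l |: A)].

Section Flip.
Variable d : nat.
Implicit Types (v x y : cube d) (A B : {set 'I_d}) (i j k l : 'I_d).

Lemma flip0 v : flip v set0 = v.
Proof. by apply/ffunP => k; rewrite ffunE inE addbF. Qed.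

Lemma flip_inj v : injective (flip v).
Proof.
move=> A B /ffunP AB; apply/setP => k.
by have := AB k; rewrite !ffunE => /addbI.
Qed.

Lemma flip_edge_in v A l : l \notin A -> flip_edge v A l \in cube_edges d.
Proof.
move=> lA; rewrite inE; apply/existsP; exists (flip v A).
apply/existsP; exists (flip v (l |: A)); rewrite eqxx andbT.
apply/cards1P; exists l; apply/setP => k; rewrite !inE !ffunE (inj_eq (@addbI _)).
by rewrite !inE; case: (k =P l) => [->|_] /=; rewrite ?(negbTE lA) ?eqxx.
Qed.

Lemma cube_adjP x y : cube_adj x y -> exists l, y = flip x [set l].
Proof.
case/cards1P=> l xy; exists l; apply/ffunP => k; rewrite ffunE -xy inE.
by case: (x k) (y k) => [] [].
Qed.

Lemma cube_edgeP v (e : {set cube d}) : v \in e -> e \in cube_edges d ->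
  exists l, e = flip_edge v set0 l.
Proof.
move=> ve; rewrite inE => /existsP[x /existsP[y /andP[xy /eqP eE]]].
rewrite eE in ve *; have [l yx] := cube_adjP xy; exists l.
rewrite /flip_edge setU0 flip0; have xl : flip y [set l] = x.
  by apply/ffunP => k; rewrite yx !ffunE -addbA addbb addbF.
by move: ve; rewrite !inE => /orP[] /eqP->; rewrite -?yx // xl setUC.
Qed.

Lemma flip_edge_inj v A B l m : l \notin A -> m \notin B ->
  flip_edge v A l = flip_edge v B m -> A = B /\ l = m.
Proof.
move=> lA mB E.
(* Each near endpoint lies on the other edge; were both of them far endpoints there, [l] would lie
   in [A]. *)
have [AB BA] : ((A == B) || (A == m |: B)) /\ ((B == A) || (B == l |: A)).
  split; rewrite -!(inj_eq (@flip_inj v)) -!in_set2.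
    by rewrite -/(flip_edge v B m) -E !inE eqxx.
  by rewrite -/(flip_edge v A l) E !inE eqxx.
have eAB : A = B.
  case/orP: AB => /eqP // AE; case/orP: BA => /eqP // BE.
  by move: lA; rewrite AE BE !inE eqxx orbT.
split=> //; have : flip v (l |: A) \in flip_edge v B m by rewrite -E !inE eqxx orbT.
rewrite !inE !(inj_eq (@flip_inj v)) -eAB => /orP[] /eqP/setP/(_ l).
  by rewrite !inE eqxx (negbTE lA).
by rewrite !inE eqxx (negbTE lA) /= orbF => /esym/eqP.
Qed.

(** Codes of the four edges of the 4-cycle at a vertex in directions [i] and [j]; they do not depend
    on the vertex. *)
Definition square_index i j : {set {set 'I_d} * 'I_d} :=
  [set (set0, i); (set0, j); ([set i], j); ([set j], i)].

Definition square v i j : {set {set cube d}} :=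
  [set flip_edge v a.1 a.2 | a in square_index i j].

Lemma squareC v i j : square v i j = square v j i.
Proof.
rewrite /square; suff -> : square_index i j = square_index j i by [].
by apply/setP => a; rewrite !inE -!orbA orbCA; do 2 congr (_ || _); rewrite orbC.
Qed.

Lemma square_sub v i j (S : {set {set cube d}}) :
  (square v i j \subset S) = [&& flip_edge v set0 i \in S,
    flip_edge v set0 j \in S, flip_edge v [set i] j \in S &
    flip_edge v [set j] i \in S].
Proof. by rewrite /square /square_index !imsetU !imset_set1 !subUset !sub1set !andbA. Qed.

Lemma square_index_proper i j a :
  i != j -> a \in square_index i j -> a.2 \notin a.1.
Proof.
move=> ij; rewrite !inE -!orbA => /or4P[] /eqP->; rewrite !inE //=.
by rewrite eq_sym.
Qed.

Lemma card_squareU v i j k l : i != j -> k != l ->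
  #|square v i j :|: square v k l| = #|square_index i j :|: square_index k l|.
Proof.
move=> ij kl; rewrite -imsetU card_in_imset // => -[A a] [B b].
have P c : c \in square_index i j :|: square_index k l -> c.2 \notin c.1.
  by case/setUP; apply: square_index_proper.
by move=> /P + /P + /flip_edge_inj; move=> Aa Bb /(_ Aa Bb) /= [-> ->].
Qed.

Lemma set1_eq i j : ([set i] == [set j]) = (i == j).
Proof. exact: inj_eq set1_inj _ _. Qed.

Lemma set0_eq1 i : (set0 == [set i]) = false.
Proof. by apply/negbTE; rewrite eq_sym -card_gt0 cards1. Qed.

Lemma card_square v i j : i != j -> #|square v i j| = 4%N.
Proof.
move=> ij; rewrite -[square v i j]setUid card_squareU // setUid.
pose s := [:: (set0, i); (set0, j); ([set i], j); ([set j], i)].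
have us : uniq s.
  by rewrite /= !inE !xpair_eqE !set0_eq1 !set1_eq eqxx (negbTE ij).
rewrite -[RHS](card_uniqP us); apply: eq_card => a.
by rewrite !inE -!orbA.
Qed.

(** The two squares share only the edge at [v] along [i], and 4 + 4 - 1 = 7. *)
Lemma card_squareU_common v i j k : i != j -> i != k -> j != k ->
  (7 <= #|square v i j :|: square v i k|)%N.
Proof.
move=> ij ik jk; rewrite card_squareU //.
have [ji ki kj] : [/\ j != i, k != i & k != j] by split; rewrite eq_sym.
pose s := [:: (set0, i); (set0, j); (set0, k); ([set i], j); ([set j], i);
              ([set i], k); ([set k], i)].
have us : uniq s.
  rewrite /= !inE !xpair_eqE !set0_eq1 !set1_eq !eqxx /=.
  by rewrite !(negbTE ij, negbTE ik, negbTE jk, negbTE ji, negbTE ki, negbTE kj).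
rewrite -[X in (X <= _)%N](card_uniqP us); apply: subset_leq_card.
by apply/subsetP/allP; rewrite /= !inE !eqxx !orbT.
Qed.

(** Every edge of a square runs along one of its two directions, so a common edge would force a
    common direction. *)
Lemma square_disjoint v i j k l : i != j -> k != l ->
  i != k -> i != l -> j != k -> j != l -> [disjoint square v i j & square v k l].
Proof.
move=> ij kl ik il jk jl; rewrite -setI_eq0 -subset0; apply/subsetP => e.
case/setIP=> /imsetP[[A x] Ax ->] /imsetP[[B y] By].
case/(flip_edge_inj (square_index_proper ij Ax) (square_index_proper kl By)).
move=> /= AB xy; move: Ax By; rewrite {}AB {}xy !inE -!orbA.
case/or4P=> /eqP[-> ->]; rewrite !xpair_eqE ?set1_eq.
all: by rewrite !(negbTE ik, negbTE il, negbTE jk, negbTE jl) ?andbF.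
Qed.

End Flip.

(** A copy of Q_2 is an arbitrary embedding; following it from [v] both ways round shows that
    opposite edges have equal directions, so it is a [square]. *)
Lemma isolated_flip d (v : cube d) i (S : {set {set cube d}}) : flip_edge v set0 i \in S ->
  flip_edge v set0 i \notin isolated S ->
  exists2 j, i != j & square v i j \subset S.
Proof.
move=> iS; rewrite in_set in_setI iS flip_edge_in ?in_set0 //= negbK.
case/existsP=> f /and3P[/injectiveP fi /forall_inP fS /exists_inP[e' e'E /eqP ie]].
(* Here [z] is the vertex sent to [v], [k] the direction in Q_2 of the edge sent to the given one,
   and [l] the other direction. *)
have : v \in [set f x | x in e'] by rewrite -ie !inE flip0 eqxx.
case/imsetP=> z ze' vz; have [k e'k] := cube_edgeP ze' e'E.
pose l := rev_ord k; have kl : k != l.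
  by rewrite /l -val_eqE /=; case: (k : 'I_2) => [[|[|]]].
have lk : l != k by rewrite eq_sym.
have adj (A : {set 'I_2}) m : m \notin A -> exists2 a,
    f (flip z (m |: A)) = flip (f (flip z A)) [set a] &
    [set f (flip z A); f (flip z (m |: A))] \in S.
  move=> mA; have := fS _ (flip_edge_in z mA).
  rewrite imsetU1 imset_set1 => /setIP[fSA fE].
  have [a fa] := cube_edgeP (set21 (f (flip z A)) (f (flip z (m |: A)))) fE.
  exists a => //; have : f (flip z (m |: A)) \in flip_edge (f (flip z A)) set0 a.
    by rewrite -fa !inE eqxx orbT.
  rewrite !inE flip0 setU0 => /orP[/eqP/fi/flip_inj/setP/(_ m)|/eqP//].
  by rewrite !inE eqxx (negbTE mA).
have [|a] := adj set0 k; first by rewrite inE.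
have [|b] := adj set0 l; first by rewrite inE.
have [|c] := adj [set k] l; first by rewrite inE.
have [|c'] := adj [set l] k; first by rewrite inE.
rewrite !setU0 flip0 -vz [l |: _]setUC => fc' Sc' fc Sc fb Sb fa Sa.
have ab : a != b.
  by apply: contraNneq kl => ab; have := fa; rewrite ab -fb => /fi/flip_inj/set1_inj->.
have ac : a != c.
  apply: contraTneq isT => ac; move: fc; rewrite fa -ac.
  have -> : flip (flip v [set a]) [set a] = v.
    by apply/ffunP => m; rewrite !ffunE -addbA addbb addbF.
  rewrite vz -{2}[z]flip0 => /fi/flip_inj/setP/(_ k).
  by rewrite !inE eqxx.
(* The corner opposite to [v] is reached by [a] then [c], and by [b] then [c']; coordinates [a] and
   [b] give [a = c'] and [b = c]. *)
have cc : flip (flip v [set a]) [set c] = flip (flip v [set b]) [set c'].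
  by rewrite -fa -fb -fc -fc'.
have ac' : a = c'.
  have /ffunP/(_ a) := cc; rewrite !ffunE !inE eqxx (negbTE ab) (negbTE ac).
  by rewrite -!addbA => /addbI/=/esym/eqP.
have bc : b = c.
  have /ffunP/(_ b) := cc; rewrite !ffunE !inE eqxx -ac' [b == a]eq_sym (negbTE ab).
  by rewrite -!addbA => /addbI/=/eqP.
have fkl : f (flip z [set k; l]) = flip v [set a; b].
  rewrite fc fa -bc; apply/ffunP => m; rewrite !ffunE !inE -addbA; congr (_ (+) _).
  by case: (m =P a) => // ->; rewrite (negbTE ab).
have ia : i = a.
  have [] // := @flip_edge_inj _ v set0 set0 i a; rewrite ?in_set0 // ie e'k.
  by rewrite imsetU1 imset_set1 !setU0 !flip0 -vz fa /flip_edge setU0 flip0.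
exists b; rewrite ia // square_sub /flip_edge !setU0 flip0 [b |: _]setUC -fkl -fa -fb.
by rewrite Sa Sb Sc Sc'.
Qed.

Definition distinct d (a : 'I_d * 'I_d) : bool := a.1 != a.2.

(** An edge of [S] along [i] that is not isolated is charged to an ordered pair with first entry
    [i], so no pair is charged twice. *)
Lemma degree_isolated d (v : cube d) (S : {set {set cube d}}) (H : graph d) :
    isolated S \subset H ->
  (\sum_i (flip_edge v set0 i \in S) <=
     degree H v + \sum_(a | distinct a) (square v a.1 a.2 \subset S))%N.
Proof.
move=> SH; rewrite -(pair_big_dep predT (fun i j => i != j)
  (fun i j => (square v i j \subset S : nat))) /=.
have degE : (\sum_i (flip_edge v set0 i \in isolated S) <= degree H v)%N.
  rewrite -big_mkcond sum1_card /degree.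
  rewrite -(@card_imset _ _ (flip_edge v set0)); last first.
    move=> i j /flip_edge_inj[] //; by rewrite in_set0.
  apply: subset_leq_card; apply/subsetP => _ /imsetP[i iS ->].
  by rewrite inE (subsetP SH) //= !inE flip0 eqxx.
apply: leq_trans (leq_add degE (leqnn _)); rewrite -big_split /=.
apply: leq_sum => i _; case: (boolP (_ \in S)) => //= iS.
case: (boolP (_ \in isolated S)) => //= iN.
have [j ij jS] := isolated_flip iS iN.
by rewrite (bigD1 j) //= jS.
Qed.

(** * Variances of the numbers of edges and squares *)

Section Variance.
Variables (R : realFieldType) (p : R) (d : nat) (v : cube d).
Hypothesis p01 : 0 <= p <= 1.

Let p0 : 0 <= p. Proof. by case/andP: p01. Qed.

Lemma degree_variance :
  mean p (fun S => (\sum_i (flip_edge v set0 i \in S)%:R - d%:R * p) ^+ 2)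
    <= d%:R * p.
Proof.
have := @variance_sub R _ p p01 _ predT (fun i => [set flip_edge v set0 i]) 1%N.
move=> /(_ (fun i _ => cards1 _)).
rewrite (@eq_mean _ _ p _ (fun S : {set {set cube d}} =>
  (\sum_i (flip_edge v set0 i \in S)%:R - d%:R * p) ^+ 2)); last first.
  move=> S; rewrite expr1 cardT size_enum_ord.
  by under eq_bigr do rewrite sub1set.
move/le_trans; apply; rewrite -[d in d%:R](card_ord d) mulr_natl -sumr_const.
apply: ler_sum => i _; rewrite (bigD1 i) //= big1 => [|j ji]; last first.
  rewrite disjoints1 inE; case: eqP => // /flip_edge_inj[]; rewrite ?in_set0 // => _ ij.
  by rewrite ij eqxx in ji.
by rewrite disjoints1 inE eqxx setUid cards1 addr0.
Qed.

(** Equal squares have 4 edges in all, squares with one common direction at least 7, and the others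
    are disjoint. A sum of indicators replaces the cases so that it can be summed over [b]. *)
Lemma square_covariance a b : distinct a -> distinct b ->
  (if [disjoint square v a.1 a.2 & square v b.1 b.2] then 0
   else p ^+ #|square v a.1 a.2 :|: square v b.1 b.2|) <=
  ((a.1 == b.1)%:R + (a.1 == b.2)%:R + (a.2 == b.1)%:R + (a.2 == b.2)%:R) * p ^+ 7
  + ((b == a)%:R + (b == (a.2, a.1))%:R) * p ^+ 4.
Proof.
case: a b => [i j] [k l] /= ij kl; rewrite /distinct /= in ij kl *.
have p4 : 0 <= p ^+ 4 by rewrite exprn_ge0.
have p7 : 0 <= p ^+ 7 by rewrite exprn_ge0.
have le7 (x y : nat) : (0 < x)%N -> p ^+ 7 <= x%:R * p ^+ 7 + y%:R * p ^+ 4.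
  by move=> x0; rewrite ler_wpDr ?mulr_ge0 // ler_peMl // ler1n.
have le4 (x y : nat) : (0 < y)%N -> p ^+ 4 <= x%:R * p ^+ 7 + y%:R * p ^+ 4.
  by move=> y0; rewrite ler_wpDl ?mulr_ge0 // ler_peMl // ler1n.
have common x y z : x != y -> x != z -> y != z ->
    p ^+ #|square v x y :|: square v x z| <= p ^+ 7.
  move=> xy xz yz; apply: ler_wiXn2l; rewrite ?p0 ?(card_squareU_common v xy xz yz) //.
  by case/andP: p01.
have same x y : x != y -> p ^+ #|square v x y :|: square v x y| = p ^+ 4.
  by move=> xy; rewrite setUid card_square.
have ji : j != i by rewrite eq_sym.
have lk : l != k by rewrite eq_sym.
rewrite -!natrD !xpair_eqE; case: ifPn => [_|].
  by rewrite addr_ge0 ?mulr_ge0.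
have [ik|ik] := eqVneq i k; [subst k|have [il|il] := eqVneq i l; [subst l|]].
- have [jl _|jl _] := eqVneq j l; first by subst l; rewrite same // le4 ?eqxx.
  by apply: le_trans (common _ _ _ ij kl jl) _; apply: le7.
- rewrite [square v k i]squareC.
  have [jk _|jk _] := eqVneq j k; first by subst k; rewrite same // le4 ?eqxx ?addn1.
  by apply: le_trans (common _ _ _ ij lk jk) _; apply: le7; rewrite ?addn1.
rewrite [square v i j]squareC; have [jk _|jk] := eqVneq j k.
  by subst k; apply: le_trans (common _ _ _ ji kl il) _; apply: le7.
have [jl _|jl] := eqVneq j l; last by rewrite square_disjoint.
subst l; rewrite [square v k j]squareC.
by apply: le_trans (common _ _ _ ji lk ik) _; apply: le7.
Qed.

Lemma sum_pair_eq1 (i : 'I_d) : \sum_(b : 'I_d * 'I_d) (i == b.1)%:R = d%:R :> R.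
Proof.
rewrite -(pair_big predT predT (fun k l : 'I_d => (i == k)%:R : R)) /=.
rewrite (eq_bigr (fun k => (i == k)%:R *+ d)) => [|k _]; last first.
  by rewrite sumr_const card_ord.
rewrite (bigD1 i) //= big1 ?eqxx ?addr0 // => k ki.
by rewrite eq_sym (negbTE ki) mul0rn.
Qed.

Lemma sum_pair_eq2 (i : 'I_d) : \sum_(b : 'I_d * 'I_d) (i == b.2)%:R = d%:R :> R.
Proof.
rewrite -(pair_big predT predT (fun k l : 'I_d => (i == l)%:R : R)) /=.
by rewrite exchange_big (pair_big _ _ (fun k l : 'I_d => (i == k)%:R : R)) sum_pair_eq1.
Qed.

Lemma square_variance :
  mean p (fun S => (\sum_(a | distinct a) (square v a.1 a.2 \subset S)%:R
                    - #|@distinct d|%:R * p ^+ 4) ^+ 2)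
    <= 4 * d%:R ^+ 3 * p ^+ 7 + 2 * d%:R ^+ 2 * p ^+ 4.
Proof.
have p4 : 0 <= p ^+ 4 by rewrite exprn_ge0.
have p7 : 0 <= p ^+ 7 by rewrite exprn_ge0.
apply: le_trans (variance_sub p01 (t := 4) _) _.
  by move=> a /(card_square v).
(* For fixed [a], each of the four coincidences sums to [d] over all [b], and each of the two
   orderings to 1; degenerate pairs only add nonnegative terms. *)
apply: (@le_trans _ _ (\sum_(a : 'I_d * 'I_d)
    (4 * d%:R * p ^+ 7 + 2 * p ^+ 4))); last first.
  rewrite sumr_const card_prod card_ord -[_ *+ (d * d)]mulr_natl natrM.
  by lra.
rewrite big_mkcond; apply: ler_sum => a _; case: ifP => [Da|_]; last first.
  by rewrite addr_ge0 ?mulr_ge0.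
rewrite (le_trans (ler_sum _ (fun b Db => square_covariance Da Db))) //.
apply: (@le_trans _ _ (\sum_(b : 'I_d * 'I_d)
  (((a.1 == b.1)%:R + (a.1 == b.2)%:R + (a.2 == b.1)%:R + (a.2 == b.2)%:R) * p ^+ 7
  + ((b == a)%:R + (b == (a.2, a.1))%:R) * p ^+ 4))).
  rewrite big_mkcond; apply: ler_sum => b _; case: ifP => // _.
  by rewrite addr_ge0 ?mulr_ge0 ?addr_ge0.
rewrite big_split -!mulr_suml !big_split /= !sum_pair_eq1 !sum_pair_eq2.
have s1 c : \sum_(b : 'I_d * 'I_d) (b == c)%:R = 1 :> R.
  by rewrite (bigD1 c) //= eqxx big1 ?addr0 // => b /negbTE->.
by rewrite !s1; lra.
Qed.

End Variance.

(** * Chebyshev's inequality for the final degree *)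

Lemma contains_Q2_set0 d : contains_Q2 (set0 : graph d) = false.
Proof.
apply/negbTE/existsP => -[f /andP[_ /forall_inP /= f0]].
have := f0 _ (@flip_edge_in 2 [ffun=> false] set0 ord0 _).
by rewrite !in_set0 => /(_ isT).
Qed.

(** With [s] the cube root of [d], all moments are rational functions of [s]. *)
Lemma final_degree_lower (R : realType) d (v : cube d) (s : R) :
    1 <= s -> d%:R = s ^+ 3 ->
  1 - 32 / s ^+ 2 <=
    final_mean (fun H : graph d => (8^-1 * s ^+ 2 <= (degree H v)%:R)%R%:R) set0.
Proof.
move=> s1 ds; set f := fun H => _; pose p : R := (2 * s)^-1.
have s0 : 0 < s by lra.
have p01 : 0 <= p <= 1.
  rewrite invr_ge0 mulr_ge0 ?(ltW s0) //= invf_le1 ?mulr_gt0 //; lra.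
rewrite -(mean_scan_mean p).
pose X (S : {set {set cube d}}) : R := \sum_i (flip_edge v set0 i \in S)%:R - d%:R * p.
pose Y (S : {set {set cube d}}) : R := \sum_(a | distinct a) (square v a.1 a.2 \subset S)%:R
  - #|@distinct d|%:R * p ^+ 4.
have s4 : 0 < s ^+ 4 by rewrite exprn_gt0.
have muX : d%:R * p = s ^+ 2 / 2 by rewrite ds /p; field; rewrite lt0r_neq0.
have muY : #|@distinct d|%:R * p ^+ 4 <= s ^+ 2 / 16.
  have -> : s ^+ 2 / 16 = (d * d)%:R * p ^+ 4.
    by rewrite natrM ds /p; field; rewrite lt0r_neq0.
  rewrite ler_wpM2r ?exprn_ge0 //; first by case/andP: p01.
  by rewrite ler_nat -[X in (X * X)%N](card_ord d) -card_prod max_card.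
(* Chebyshev in pointwise form, with [X] and [Y] the centred counts: the scan mean is compared with
   a quadratic for each [S]. *)
apply: (@le_trans _ _ (mean p (fun S => 1 + - (32 / s ^+ 4) * (X S ^+ 2 + Y S ^+ 2)))).
  rewrite meanD mean_const meanZ meanD.
  have VX := degree_variance v p01.
  have VY := square_variance v p01.
  have : mean p (fun S => X S ^+ 2) + mean p (fun S => Y S ^+ 2) <= s ^+ 2.
    apply: le_trans (lerD VX VY) _; rewrite muX.
    (* Here 4/128 + 2/16 = 5/32; with 1/2 from [X] the total stays below 1. *)
    have -> : 4 * d%:R ^+ 3 * p ^+ 7 + 2 * d%:R ^+ 2 * p ^+ 4 = (5 / 32) * s ^+ 2.
      by rewrite ds /p; field; rewrite lt0r_neq0.
    by have := sqr_ge0 s; lra.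
  move=> V; have -> : 32 / s ^+ 2 = 32 / s ^+ 4 * s ^+ 2.
    by field; rewrite lt0r_neq0.
  by rewrite mulNr lerD2l lerN2 ler_wpM2l // divr_ge0 // ltW.
apply: le_mean => // S; have [XY|XY] := leP (8^-1 * s ^+ 2)
    (\sum_i (flip_edge v set0 i \in S)%:R
     - \sum_(a | distinct a) (square v a.1 a.2 \subset S)%:R).
  rewrite (@scan_mean_isolated _ _ _ S 1) ?sub0set ?contains_Q2_set0 //.
  - rewrite mulNr gerBl mulr_ge0 ?addr_ge0 ?sqr_ge0 // divr_ge0 // ltW //.
  - move=> H /(degree_isolated v); rewrite -(ler_nat R) natrD !natr_sum => dH.
    by rewrite /f (le_trans XY) // lerBlDr.
  by rewrite set0U; apply/subsetP => e; rewrite in_set => /andP[/setIP[]].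
(* In the bad case [Y S - X S] is at least (1/2 - 1/16 - 1/8) s^2 = (5/16) s^2. The sum of squares
   is at least half its square, (25/512) s^4, which exceeds s^4/32: hence the constant 32. *)
apply: (@le_trans _ _ 0); last by apply: scan_mean_ge0 => H; rewrite /f ler0n.
suff : 1 <= 32 / s ^+ 4 * (X S ^+ 2 + Y S ^+ 2) by lra.
rewrite mulrAC ler_pdivlMr // mul1r.
have -> : s ^+ 4 = (s ^+ 2) ^+ 2 by ring.
have : 5 / 16 * s ^+ 2 <= Y S - X S by rewrite /X /Y muX; lra.
have := sqr_ge0 (X S + Y S); move: (sqr_ge0 s) => + + h.
set q := s ^+ 2 in h *; set z := Y S - X S in h => q0.
have -> : X S ^+ 2 + Y S ^+ 2 = ((X S + Y S) ^+ 2 + z ^+ 2) / 2 by rewrite /z; field.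
by move=> w0; nra.
Qed.

Lemma prob_final_vertexE (R : realType) d (A : graph d -> cube d -> bool) :
  prob_final_vertex R A =
  (\sum_v final_mean (fun H => (A H v)%:R : R) set0) / #|cube d|%:R.
Proof.
rewrite mulr_suml; apply: eq_bigr => v _; rewrite -final_lawE mulr_suml big_mkcond.
by apply: eq_bigr => H _; case: (A H v); rewrite ?mulr1 // mulr0 mul0r.
Qed.

Lemma prob_final_bounds (R : realType) d (s : R) : 1 <= s -> d%:R = s ^+ 3 ->
  1 - 32 / s ^+ 2 <=
    prob_final_vertex R (fun (G : graph d) (v : cube d) =>
      8^-1 * s ^+ 2 <= (degree G v)%:R) <= 1.
Proof.
move=> s1 ds; rewrite prob_final_vertexE.
have n0 : 0 < #|cube d|%:R :> R.
  by rewrite ltr0n; apply/card_gt0P; exists [ffun=> false].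
rewrite ler_pdivlMr // ler_pdivrMr // !mulr_natr -!sumr_const.
rewrite !ler_sum // => v _; last exact: final_degree_lower.
apply: (andP (iter_step_mean_bounds (a := 0) _ _ _)).2 => H.
by rewrite ler0n lern1 leq_b1.
Qed.

(* The limit as d tends to infinity *)
From mathcomp Require Import all_classical all_reals all_analysis.
Import numFieldNormedType.Exports.
Local Open Scope classical_set_scope.
Local Open Scope ring_scope.

Theorem theorem2p2 (R : realType) :
  exists c : R, 0 < c /\
    prob_final_vertex R (fun (G : graph d) (v : cube d) =>
      c * d%:R `^ (2 / 3) <= (degree G v)%:R) @[d --> \oo] --> (1 : R).
Proof.
exists 8^-1; split; first by lra.
apply/cvgrPdist_le => e e0; near=> d.
have d1 : 1 <= d%:R :> R by rewrite ler1n; near: d; exact: nbhs_infty_gt.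
(* This threshold makes [s ^+ 2], the power 2/3 of [d], at least [32 / e]. *)
have dB : (32 / e) `^ (3 / 2) <= d%:R :> R by near: d; exact: nbhs_infty_ger.
have d0 : 0 <= d%:R :> R by rewrite ler0n.
pose s : R := d%:R `^ (1 / 3).
have s1 : 1 <= s by rewrite -(powRr0 d%:R) ler_powR //; lra.
have s2 : d%:R `^ (2 / 3) = s ^+ 2.
  by rewrite -powR_mulrn ?powR_ge0 // -powRrM; congr (_ `^ _); field.
have s3 : d%:R = s ^+ 3.
  by rewrite -powR_mulrn ?powR_ge0 // -powRrM mul1r mulVf ?powRr1.
have se : 32 / s ^+ 2 <= e.
  rewrite ler_pdivrMr ?exprn_gt0 ?(lt_le_trans ltr01) // mulrC -ler_pdivrMr // -s2.
  have -> : 32 / e = ((32 / e) `^ (3 / 2)) `^ (2 / 3).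
    rewrite -powRrM (_ : 3 / 2 * (2 / 3) = 1); last by field.
    by rewrite powRr1 // divr_ge0 // ltW.
  by apply: ge0_ler_powR; rewrite ?nnegrE ?powR_ge0 //; lra.
have /andP[lo hi] := prob_final_bounds s1 s3.
rewrite s2 ger0_norm; lra.
Unshelve. all: by end_near.
Qed.
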